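(* Let $L$ be the Cayley table of a finite right Bol loop $Q$. Fix $p=(r_p,c_p,r_pc_p)\in X(L)$, and let $\pi=\pi_{L,p}$ be the associated permutation of $Q-\{c_p\}$. Then $\pi^2=\mathrm{id}$ and $\pi(c)=(c_pc^{-1})c_p$ for all $c\in Q-\{c_p\}$. Moreover, for $c\in Q-\{c_p\}$, $\pi(c)=c$ if and only if $cc_p^{-1}=c_pc^{-1}$.
   Context: A quasigroup is a set $Q$ with a binary operation, written as juxtaposition, such that for all $a,b\in Q$ there exist unique $c,d\in Q$ with $ac=b$ and $da=b$. A loop is a quasigroup with a two-sided identity element $\iota$. A right Bol loop is a loop $Q$ satisfying $((ca)b)a=c((ab)a)$ for all $a,b,c\in Q$. Every element $a$ of a right Bol loop has a two-sided inverse, denoted $a^{-1}$ (so $aa^{-1}=a^{-1}a=\iota$). The Cayley table $L$ of a finite quasigroup $Q$ is the Latin square with rows and columns indexed by $Q$ and $(a,b)$-entry $L(a,b)=ab$. Put $X(L)=\{(a,b,ab)\mid a,b\in Q\}$; any two components of an element of $X(L)$ determine the third. For $p=(r_p,c_p,r_pc_p)\in X(L)$, the permutation $\pi=\pi_{L,p}$ of $Q-\{c_p\}$ is defined as follows. For $c\in Q-\{c_p\}$, let $x=(r_p,c,r_pc)\in X(L)$; let $y=(r,c_p,r_pc)$ be the unique element of $X(L)$ with second component $c_p$ and third component $r_pc$ (this determines $r$); let $z=(r,c',r_pc_p)$ be the unique element of $X(L)$ with first component $r$ and third component $r_pc_p$ (this determines $c'$). Then $\pi(c)=c'$. *)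

(* Defs.v *)
From mathcomp Require Import all_boot fingroup perm.

Set Implicit Arguments.
Unset Strict Implicit.
Unset Printing Implicit Defensive.

Declare Scope loop_scope.
Delimit Scope loop_scope with loop.
Local Open Scope loop_scope.

Record finQuasigroup := FinQuasigroup {
  quasi_sort :> finType;
  quasi_mul : quasi_sort -> quasi_sort -> quasi_sort;
  quasi_div : forall a b : quasi_sort,
    (exists! c, quasi_mul a c = b) /\ (exists! d, quasi_mul d a = b)
}.

Notation "a * b" := (quasi_mul a b) : loop_scope.

Record finLoop := FinLoop {
  loop_quasi :> finQuasigroup;
  loop_one : loop_quasi;
  loop_mul1 : forall a : loop_quasi, loop_one * a = a /\ a * loop_one = a
}.

Arguments loop_one {_}.
Notation "1" := loop_one : loop_scope.

Record finRightBolLoop := FinRightBolLoop {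
  bol_loop :> finLoop;
  right_bol : forall a b c : bol_loop, ((c * a) * b) * a = c * ((a * b) * a)
}.

Section Division.
Variable Q : finQuasigroup.
Implicit Types a b c d : Q.

Lemma quasi_mulgI a : injective (fun c : Q => a * c).
Proof.
move=> c c' e; have [[x [_ ux]] _] := quasi_div a (a * c).
by rewrite -(ux c) // -(ux c').
Qed.

Lemma quasi_mulIg a : injective (fun d : Q => d * a).
Proof.
move=> d d' e; have [_ [x [_ ux]]] := quasi_div a (d * a).
by rewrite -(ux d) // -(ux d').
Qed.

(* [ldiv a b] is the unique [c] such that [a * c = b], and
   [rdiv b a] is the unique [d] such that [d * a = b]. *)
Definition ldiv a b : Q := invF (@quasi_mulgI a) b.
Definition rdiv b a : Q := invF (@quasi_mulIg a) b.

Lemma mul_ldiv a b : a * ldiv a b = b.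
Proof. exact: (f_invF (@quasi_mulgI a) b). Qed.

Lemma mul_rdiv b a : rdiv b a * a = b.
Proof. exact: (f_invF (@quasi_mulIg a) b). Qed.

End Division.

(* In a right Bol loop this right inverse is two-sided: see [mulVb]. *)
Definition loop_inv (Q : finLoop) (a : Q) : Q := ldiv a 1.

Notation "a ^-1" := (loop_inv a) : loop_scope.

Lemma mulbV (Q : finLoop) (a : Q) : a * a^-1 = 1.
Proof. exact: mul_ldiv. Qed.

Lemma mulVb (Q : finRightBolLoop) (a : Q) : a^-1 * a = 1.
Proof.
have := right_bol a (a^-1) (rdiv 1 a).
by rewrite mul_rdiv mulbV !(loop_mul1 _).1 mul_rdiv.
Qed.

Definition cayley_table (Q : finQuasigroup) (a b : Q) : Q := a * b.

Definition table_entries (Q : finQuasigroup) : {set (Q * Q * Q)%type} :=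
  [set (a, b, cayley_table a b) | a : Q, b : Q].

(* The elements p of X(L), L being the Cayley table of Q. *)
Definition entry (Q : finQuasigroup) := {x : (Q * Q * Q)%type | x \in table_entries Q}.

Definition entry_row (Q : finQuasigroup) (p : entry Q) : Q := (val p).1.1.
Definition entry_col (Q : finQuasigroup) (p : entry Q) : Q := (val p).1.2.
Definition entry_sym (Q : finQuasigroup) (p : entry Q) : Q := (val p).2.

Lemma table_entriesE (Q : finQuasigroup) (a b c : Q) :
  ((a, b, c) \in table_entries Q) = (a * b == c).
Proof.
apply/imset2P/eqP => [[a' b' _ _ [-> -> ->]] //|<-].
by exists a b.
Qed.

Lemma entry_symE (Q : finQuasigroup) (p : entry Q) : entry_sym p = entry_row p * entry_col p.
Proof.
by case: p => [[[r c] s] ps]; apply/esym/eqP; rewrite -table_entriesE.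
Qed.

Section Pi.
Variables (Q : finQuasigroup) (p : entry Q).

(* [pi_y c] is the entry in column [entry_col p] with the symbol of [pi_x c];
   [pi_z c] is the entry in the row of [pi_y c] with the symbol of [p]; the
   permutation sends [c] to the column of [pi_z c]. *)
Definition pi_x (c : Q) : (Q * Q * Q)%type := (entry_row p, c, entry_row p * c).
Definition pi_y (c : Q) : (Q * Q * Q)%type :=
  (rdiv (pi_x c).2 (entry_col p), entry_col p, (pi_x c).2).
Definition pi_z (c : Q) : (Q * Q * Q)%type :=
  ((pi_y c).1.1, ldiv (pi_y c).1.1 (entry_sym p), entry_sym p).
Definition pi_fun (c : Q) : Q := (pi_z c).1.2.

Lemma pi_x_entry c : pi_x c \in table_entries Q.
Proof. by rewrite table_entriesE. Qed.

Lemma pi_y_entry c : pi_y c \in table_entries Q.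
Proof. by rewrite table_entriesE mul_rdiv. Qed.

Lemma pi_z_entry c : pi_z c \in table_entries Q.
Proof. by rewrite table_entriesE mul_ldiv. Qed.

Lemma mul_pi_fun c :
  rdiv (entry_row p * c) (entry_col p) * pi_fun c = entry_sym p.
Proof. exact: mul_ldiv. Qed.

Lemma pi_fun_neq c : c != entry_col p -> pi_fun c != entry_col p.
Proof.
apply: contraNneq => e; apply/eqP; apply: (quasi_mulgI (a := entry_row p)).
by rewrite -entry_symE -(mul_pi_fun c) e mul_rdiv.
Qed.

Lemma pi_fun_inj : injective pi_fun.
Proof.
move=> c c' e; have := mul_pi_fun c; rewrite -(mul_pi_fun c') e.
move=> /quasi_mulIg er; apply: (quasi_mulgI (a := entry_row p)).
by rewrite -[LHS](mul_rdiv _ (entry_col p)) er mul_rdiv.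
Qed.

Definition col_compl := {c : Q | c != entry_col p}.

Definition pi_sub (c : col_compl) : col_compl :=
  Sub (pi_fun (val c)) (pi_fun_neq (valP c)).

Lemma pi_sub_inj : injective pi_sub.
Proof. by move=> c c' /(congr1 val) /pi_fun_inj /val_inj. Qed.

Definition pi_perm : {perm col_compl} := perm pi_sub_inj.

End Pi.

(* Main.v *)
Require Import Defs.
From mathcomp Require Import all_boot fingroup perm.
Local Open Scope loop_scope.

(** Write [r] for the row and [q] for the column of the entry [p].  By
definition, [pi c] is the solution [x] of [d * x = r * q], where
[d * q = r * c].  The right Bol identity, read from right to left, gives
[d * ((q * c^-1) * q) = ((d * q) * c^-1) * q = ((r * c) * c^-1) * q], and this
is [r * q] by the right inverse property (lemma [mulbK]).  Hence
[pi c = (q * c^-1) * q], which does not depend on [r].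

Inversion commutes with such sandwiches, [((q * c^-1) * q)^-1 = (q^-1 * c) *
q^-1] (lemma [invb_sandwich]), so applying the formula twice gives back [c].
The fixed point criterion is the formula with the last factor [q] moved to the
other side. *)

Section RightBolLoop.
Variable Q : finRightBolLoop.
Implicit Types a b c d : Q.

(** The right inverse property: the right Bol identity with [b = a^-1] reads
    [((c * a) * a^-1) * a = c * a], and [a] cancels. *)
Lemma mulbK a c : (c * a) * a^-1 = c.
Proof.
apply: (quasi_mulIg (a := a)).
by rewrite /= right_bol mulbV (loop_mul1 _).1.
Qed.

Lemma mulbVK a c : (c * a^-1) * a = c.
Proof. by apply: (quasi_mulIg (a := a^-1)); rewrite /= mulbK. Qed.

Lemma mulb1_inv a b : a * b = 1 -> a^-1 = b.
Proof. by move=> ab1; apply: (quasi_mulgI (a := a)); rewrite /= mulbV. Qed.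

Lemma invb_sandwich a c : ((a * c^-1) * a)^-1 = (a^-1 * c) * a^-1.
Proof. by apply: mulb1_inv; rewrite -right_bol mulbK mulbVK mulbV. Qed.

Lemma sandwichK a c : (a * ((a * c^-1) * a)^-1) * a = c.
Proof. by rewrite invb_sandwich -right_bol mulbV (loop_mul1 _).1 mulbVK. Qed.

Lemma pi_fun_bol (p : entry Q) c :
  pi_fun p c = (entry_col p * c^-1) * entry_col p.
Proof.
apply: (quasi_mulgI (a := rdiv (entry_row p * c) (entry_col p))) => /=.
by rewrite mul_pi_fun -right_bol mul_rdiv mulbK entry_symE.
Qed.

End RightBolLoop.

Theorem theorem6p2 (Q : finRightBolLoop) (p : entry Q) :
  [/\ (pi_perm p ^+ 2 = 1)%g,
      (forall c : col_compl p,
         val (pi_perm p c) = (entry_col p * (val c)^-1) * entry_col p)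
    & (forall c : col_compl p,
         pi_perm p c = c <->
         val c * (entry_col p)^-1 = entry_col p * (val c)^-1)].
Proof.
have piE (c : col_compl p) :
    val (pi_perm p c) = (entry_col p * (val c)^-1) * entry_col p.
  by rewrite permE; apply: pi_fun_bol.
split=> // [|c].
  apply/permP => c; apply: val_inj.
  by rewrite expgS expg1 permM perm1 !piE sandwichK.
split=> [fix_c | e].
  by rewrite -{1}fix_c piE mulbK.
by apply: val_inj; rewrite piE -e mulbVK.
Qed.
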